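(* Let $\mathbb{K}$ be a field of characteristic zero and let $I\subset S=\mathbb{K}[x_1,\dots,x_n]$ be an artinian monomial ideal generated in degree $d$. Suppose there exist integers $1\le i<j\le n$ such that for every monomial $m\in S_d$ one has $x_ix_j\mid m$ if and only if $m\notin I$. Then $S/I$ has the strong Lefschetz property.
   Context: $S$ is standard graded. ''Generated in degree $d$'' means that all minimal generators of $I$ are homogeneous of degree $d$. For an artinian homogeneous ideal $I$, $S/I$ has the strong Lefschetz property (SLP) if there is a linear form $\ell\in (S/I)_1$ such that for all integers $j$ and all $k$ the multiplication map $\times\ell^k:(S/I)_j\to (S/I)_{j+k}$ has maximal rank, i.e. is injective or surjective. *)

(* Defs.v *)
From HB Require Import structures.
From mathcomp Require Import all_boot all_order all_algebra.
From mathcomp Require Export mpoly.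

Set Implicit Arguments.
Unset Strict Implicit.
Unset Printing Implicit Defensive.

Import GRing.Theory.
Local Open Scope ring_scope.
Local Open Scope quotient_scope.

(* [idealr] of ring_quotient only covers proper ideals; the ideals below may
   contain 1, so that the quotient may be the zero ring. *)
HB.mixin Record isIdeal (R : comPzRingType) (I : R -> bool) := {
  ideal_mull : forall a, {in I, forall u, a * u \in I}
}.

#[short(type="ideal")]
HB.structure Definition Ideal (R : comPzRingType) :=
  {I of GRing.ZmodClosed R I & isIdeal R I}.

Section IdealQuotient.
Variables (R : comPzRingType) (I : ideal R).

Definition ideal_quotient := {ideal_quot I}.
Local Notation Q := ideal_quotient.

HB.instance Definition _ := GRing.Zmodule.on Q.
HB.instance Definition _ := EqQuotient.on Q.
HB.instance Definition _ := ZmodQuotient.on Q.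

Definition quot_mul : Q -> Q -> Q := lift_op2 Q *%R.

Lemma eq_quotP (p q : R) : reflect (\pi_Q p = \pi_Q q) (p - q \in I).
Proof. by rewrite Quotient.idealrBE; apply: eqP. Qed.

Lemma quot_mulE (p q : R) : quot_mul (\pi_Q p) (\pi_Q q) = \pi_Q (p * q).
Proof.
unlock quot_mul; apply/eq_quotP.
set p' := repr _; set q' := repr _.
have hp : p' - p \in I by apply/eq_quotP; rewrite reprK.
have hq : q' - q \in I by apply/eq_quotP; rewrite reprK.
have -> : p' * q' - p * q = q' * (p' - p) + p * (q' - q).
  by rewrite !mulrBr [q' * p']mulrC [q' * p]mulrC addrA subrK.
by rewrite rpredD ?ideal_mull.
Qed.

Lemma quot_mulA : associative quot_mul.
Proof.
by move=> x y z; rewrite -[x]reprK -[y]reprK -[z]reprK !quot_mulE mulrA.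
Qed.

Lemma quot_mulC : commutative quot_mul.
Proof. by move=> x y; rewrite -[x]reprK -[y]reprK !quot_mulE mulrC. Qed.

Lemma quot_mul1 : left_id (\pi_Q 1) quot_mul.
Proof. by move=> x; rewrite -[x]reprK quot_mulE mul1r. Qed.

Lemma quot_mulDl : left_distributive quot_mul +%R.
Proof.
move=> x y z; rewrite -[x]reprK -[y]reprK -[z]reprK.
by rewrite -(raddfD (\pi_Q)) !quot_mulE mulrDl raddfD.
Qed.

HB.instance Definition _ := GRing.Zmodule_isComPzRing.Build Q
  quot_mulA quot_mulC quot_mul1 quot_mulDl.

Definition quot_proj (p : R) : Q := \pi_Q p.

Lemma quot_proj_zmod_morphism : zmod_morphism quot_proj.
Proof. by move=> p q; rewrite /quot_proj raddfB. Qed.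

Lemma quot_proj_monoid_morphism : monoid_morphism quot_proj.
Proof. by split=> // p q; rewrite /quot_proj -quot_mulE. Qed.

HB.instance Definition _ := GRing.isZmodMorphism.Build R Q quot_proj
  quot_proj_zmod_morphism.
HB.instance Definition _ := GRing.isMonoidMorphism.Build R Q quot_proj
  quot_proj_monoid_morphism.

Lemma quot_proj_eqP (p q : R) :
  reflect (quot_proj p = quot_proj q) (p - q \in I).
Proof. exact: eq_quotP. Qed.

Lemma quot_proj_surj (x : Q) : exists p, quot_proj p = x.
Proof. by exists (repr x); rewrite /quot_proj reprK. Qed.

End IdealQuotient.

Definition artinian_ring (R : comPzRingType) : Prop :=
  forall J : nat -> ideal R,
    (forall t, {subset J t.+1 <= J t}) ->
    exists N, forall t, (N <= t)%N -> J t =i J N.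

Definition artinian_ideal (R : comPzRingType) (I : ideal R) : Prop :=
  artinian_ring (ideal_quotient I).

Definition ideal_span (R : comPzRingType) (G : R -> Prop) (p : R) : Prop :=
  exists (r : nat) (a g : 'I_r -> R),
    (forall t, G (g t)) /\ p = \sum_(t < r) a t * g t.

Definition generates (R : comPzRingType) (G : R -> Prop) (I : ideal R) : Prop :=
  forall p, p \in I <-> ideal_span G p.

Definition minimally_generates (R : comPzRingType) (G : R -> Prop)
    (I : ideal R) : Prop :=
  generates G I /\
  forall G' : R -> Prop, (forall g, G' g -> G g) -> generates G' I ->
    forall g, G g -> G' g.

Section Graded.
Variables (K : fieldType) (n : nat).
Implicit Types (I : ideal {mpoly K[n]}) (d j k : nat).

Definition monomial_ideal I : Prop :=
  exists A : 'X_{1..n} -> Prop,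
    generates (fun p => exists2 m, A m & p = 'X_[m]) I.

(* Only generating sets made of homogeneous polynomials count: (x^2, y^2) is
   also minimally generated by x^2 (1 + y) and y^2. *)
Definition generated_in_degree I d : Prop :=
  forall G : {mpoly K[n]} -> Prop,
    minimally_generates G I ->
    (forall g, G g -> exists e, g \is e.-homog) ->
    forall g, G g -> g \is d.-homog.

Definition quot_component I j (x : ideal_quotient I) : Prop :=
  exists2 p : {mpoly K[n]}, p \is j.-homog & x = quot_proj I p.

Definition strong_lefschetz_property I : Prop :=
  exists2 l : ideal_quotient I, quot_component 1 l &
    forall j k,
      (forall x y, quot_component j x -> quot_component j y ->
         l ^+ k * x = l ^+ k * y -> x = y)
      \/
      (forall z, quot_component (j + k) z ->
         exists2 x, quot_component j x & l ^+ k * x = z).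

End Graded.

(* Main.v *)
Require Import Defs.
From mathcomp Require Import all_boot all_order all_algebra zify.
Local Open Scope ring_scope.
Import GRing.Theory.

Set Implicit Arguments.
Unset Strict Implicit.
Unset Printing Implicit Defensive.

(** Write d = D + 1, x = x_i and y = x_j. The Lefschetz element is l = x + y.

    Since I is generated by the monomials of degree d not divisible by xy, a
    monomial of degree D + N lies outside I exactly when (xy)^N divides it
    ([mnm_notin_degD]). Dividing by (xy)^N identifies (S/I)_(D+N) with S_(D-N),
    so the Hilbert function is symmetric about D, and maximal rank in all
    degrees follows once l^(2N) maps (S/I)_(D-N) = S_(D-N) bijectively onto
    (S/I)_(D+N).

    Multiplication by l does not touch the other variables. For a fixed
    monomial m0 in them, the forms m0 * p(x, y) with p of degree s are encoded,
    by setting y = 1, as polynomials p in one variable of degree at most s, and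
    multiplication by l becomes multiplication by 1 + X ([fibreM_exp],
    [homogenizeM_exp]). The claim becomes that p is determined by, and may be
    chosen to prescribe, the coefficients of X^N, ..., X^(N+s) in
    (1 + X)^(2N) p. This is a square linear system ([central_mx_unit]) whose
    kernel vanishes ([gap_poly_eq0]): differentiating N times a multiple g of
    (1 + X)^(2N) with such a gap in its coefficients gives a polynomial of
    degree at most N + s divisible by both X^(s+1) and (1 + X)^N, hence zero.
    Thus g has degree less than N in characteristic zero, and so g = 0. *)

(** * Multiples of powers of 1 + X with a gap *)

Section CentralCoefficients.
Variable K : fieldType.
Hypothesis charK0 : [pchar K] =i pred0.

Lemma size_XD1_exp k : size (('X + 1 : {poly K}) ^+ k) = k.+1.
Proof. by rewrite -[1]polyC1 -[_%:P]opprK -polyCN size_exp_XsubC. Qed.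

Lemma dvdp_derivn (q p : {poly K}) (a k : nat) :
  q ^+ (a + k) %| p -> q ^+ a %| p^`(k).
Proof.
elim: k a => [|k IH] a; first by rewrite addn0.
rewrite derivnS addnS -addSn => /IH/dvdpP[r ->].
rewrite derivM deriv_exp exprS dvdp_add //.
  by rewrite mulrCA mulrA dvdp_mulIr.
by rewrite /= mulrnAr -!mulrnAl !mulrA dvdp_mulIr.
Qed.

(** The kernel half of the argument: the N-th derivative removes the part of g
    below the gap and turns the gap into divisibility by X^(s+1), at the cost
    of only N of the 2N factors 1 + X. Those left over, together with
    X^(s+1), exceed the degree. *)
Lemma gap_poly_eq0 (N s : nat) (g : {poly K}) :
  ('X + 1) ^+ N.*2 %| g -> (size g <= N.*2 + s.+1)%N ->
  (forall c, (c <= s)%N -> g`_(N + c) = 0) -> g = 0.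
Proof.
move=> Yg sg g0.
have dY : ('X + 1) ^+ N %| g^`(N) by apply: dvdp_derivn; rewrite addnn.
have sdg : (size g^`(N) <= N + s.+1)%N.
  apply/leq_sizeP => c le_c; rewrite coef_derivn.
  by move/leq_sizeP: sg => ->; rewrite ?mul0rn // -addnn -addnA leq_add2l.
have dX : 'X ^+ s.+1 %| g^`(N).
  rewrite -(poly_take_drop s.+1 g^`(N)) dvdp_addl ?dvdp_mulIr //.
  suff -> : take_poly s.+1 g^`(N) = 0 by rewrite dvdp0.
  apply/polyP=> c; rewrite coef_take_poly coef0; case: ifP => // lt_c.
  by rewrite coef_derivn g0 ?mul0rn.
have coXY : coprimep (('X + 1) ^+ N) ('X ^+ s.+1 : {poly K}).
  rewrite coprimep_expl // coprimep_expr // coprimepX rootE !hornerE.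
  by rewrite ?add0r oner_eq0.
have dg0 : g^`(N) = 0.
  apply/eqP; apply: contraT => nz.
  have : ('X + 1) ^+ N * 'X ^+ s.+1 %| g^`(N) by rewrite Gauss_dvdp // dY.
  move/(dvdp_leq nz).
  rewrite size_Mmonic ?monicXn ?monic_neq0 ?monic_exp ?monicXaddC //.
  rewrite size_XD1_exp size_polyXn.
  by rewrite addSn /= addnS leqNgt ltnS sdg.
have sgN : (size g <= N)%N.
  apply/leq_sizeP => c /subnKC <-; apply/eqP.
  have /eqP := congr1 (fun p : {poly K} => p`_(c - N)) dg0.
  rewrite coef0 coef_derivn -mulr_natr mulf_eq0.
  move/pcharf0P: charK0 => ->.
  by rewrite -leqn0 leqNgt ffact_gt0 leq_addr orbF.
apply/eqP; apply: contraT => nz.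
have := dvdp_leq nz Yg.
rewrite size_XD1_exp => h.
have := leq_trans h sgN.
by rewrite -addnn ltnNge leq_addr.
Qed.

(** The matrix of p |-> the coefficients of X^N, ..., X^(N+s) in
    (1 + X)^(2N) p on polynomials of degree at most s, acting on rows. Its
    entries are the binomials C(2N, N + a - b). *)
Definition central_mx N s : 'M[K]_s.+1 :=
  \matrix_(b, a) (('X + 1) ^+ N.*2 * 'X^b)`_(N + a).

Lemma mul_central_mx N s (v : 'rV[K]_s.+1) a :
  (v *m central_mx N s) 0 a = (('X + 1) ^+ N.*2 * rVpoly v)`_(N + a).
Proof.
rewrite mxE [rVpoly v]poly_def mulr_sumr coef_sum; apply: eq_bigr => b _.
by rewrite mxE -scalerAr coefZ valK.
Qed.

Lemma central_mx_unit N s : central_mx N s \in unitmx.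
Proof.
rewrite -row_free_unit; apply: inj_row_free => v vM0.
set q := ('X + 1 : {poly K}) ^+ N.*2.
have sqv : (size (q * rVpoly v)%R <= N.*2 + s.+1)%N.
  apply: leq_trans (size_polyMleq _ _) _.
  by rewrite size_XD1_exp addSn leq_add2l size_poly.
have /eqP: q * rVpoly v = 0.
  apply: gap_poly_eq0 (dvdp_mulIl _ _) sqv _ => c le_c.
  by rewrite -(mul_central_mx N v (Ordinal (le_c : (c < s.+1)%N))) vM0 mxE.
rewrite mulf_eq0 -size_poly_eq0 size_XD1_exp /= => /eqP v0.
by apply: (can_inj rVpolyK); rewrite v0 linear0.
Qed.
End CentralCoefficients.

(** * Minimal generators of a monomial ideal *)

Section MonomialIdeal.
Variables (K : fieldType) (n : nat) (I : ideal {mpoly K[n]}).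
Implicit Types (m : 'X_{1..n}) (p : {mpoly K[n]}).

Lemma mpolyX_mem_le m' m : (m' <= m)%MM -> 'X_[m'] \in I -> 'X_[m] \in I.
Proof. by move=> /submK <- Im'; rewrite mpolyXD ideal_mull. Qed.

Lemma mem_ideal_supp p : {in msupp p, forall m, 'X_[m] \in I} -> p \in I.
Proof.
move=> Ip; rewrite [p]mpolyE big_seq; apply: rpred_sum => m /Ip Im.
by rewrite -mul_mpolyC ideal_mull.
Qed.

Lemma span_monomials_supp (A : 'X_{1..n} -> Prop) p :
    ideal_span (fun q => exists2 m, A m & q = 'X_[m]) p ->
  {in msupp p, forall m, exists2 m', A m' & (m' <= m)%MM}.
Proof.
move=> [r [a [g [gA ->]]]] m; rewrite mcoeff_msupp raddf_sum /= => nz.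
have [t nzt] : exists t, (a t * g t)@_m != 0.
  apply/existsP; apply: contraNT nz => /existsPn h.
  by rewrite big1 // => t _; apply/eqP; have := h t; rewrite negbK.
have [m' Am' gt] := gA t; exists m' => //.
move: nzt; rewrite gt -mcoeff_msupp (perm_mem (msuppMX _ _)) => /mapP[k _ ->].
exact: lem_addr.
Qed.

Hypothesis monI : monomial_ideal I.

Lemma monomial_ideal_supp p : p \in I -> {in msupp p, forall m, 'X_[m] \in I}.
Proof.
have [A genA] := monI; move=> /genA/span_monomials_supp suppA m /suppA[m' Am'].
move/mpolyX_mem_le; apply; apply/genA; exists 1%N, (fun=> 1), (fun=> 'X_[m']).
by split=> [_|]; [exists m' | rewrite big_ord1 mul1r].
Qed.

(** Minimality is only tested against division by one variable, which keeps it
    decidable. *)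
Definition minimal_monomial m :=
  ('X_[m] \in I) &&
  [forall k, (U_(k) <= m)%MM ==> ('X_[K, m - U_(k)] \notin I)].

Lemma minimal_monomialP m m' :
  minimal_monomial m -> 'X_[m'] \in I -> (m' <= m)%MM -> m' = m.
Proof.
move=> /andP[_ /forallP minm] Im' /mnm_lepP le_m'm.
apply/eqP; apply: contraT => neq.
have [k lt_k] : exists k, (m' k < m k)%N.
  apply/existsP; apply: contraNT neq => /existsPn ge_m'm.
  apply/eqP/mnmP => k; apply/eqP; rewrite eqn_leq le_m'm.
  by rewrite leqNgt (negPf (ge_m'm k)).
have := minm k; rewrite lep1mP -lt0n (leq_trans _ lt_k) //=.
rewrite (@mpolyX_mem_le m') //; apply/mnm_lepP=> l.
rewrite mnmBE mnm1E; case: eqP => [<-|_]; last by rewrite subn0.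
by rewrite subn1 -ltnS prednK // (leq_trans _ lt_k).
Qed.

Lemma exists_minimal_monomial m :
  'X_[m] \in I -> exists2 m', minimal_monomial m' & (m' <= m)%MM.
Proof.
elim: {m}_.+1 {-2}m (ltnSn (mdeg m)) => // e IH m lt_m Im.
have [minm|] := boolP (minimal_monomial m);
  first by exists m => //; apply: lepm_refl.
rewrite /minimal_monomial Im /= => /forallPn[k].
rewrite negb_imply negbK => /andP[km Imk].
have [|m' minm' le_m'] := IH _ _ Imk.
  by rewrite -(submK km) mdegD mdeg1 addn1 in lt_m.
by exists m' => //; apply: lepm_trans le_m' (lem_subr _ _).
Qed.

(** The monomials in a combination of monomial generators are multiples of
    these generators, so a minimal monomial of I must itself occur in any set
    of monomials generating I. *)
Lemma minimal_monomials_generate :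
  minimally_generates (fun p => exists2 m, minimal_monomial m & p = 'X_[m]) I.
Proof.
split=> [p|G subG genG _ [m minm ->]].
  split=> [Ip|[r [a [g [gmin ->]]]]]; last first.
    apply: rpred_sum => t _; have [m /andP[Im _] ->] := gmin t.
    exact: ideal_mull.
  pose s := msupp p.
  have exmin (t : 'I_(size s)) :
      exists m', minimal_monomial m' && (m' <= nth 0%MM s t)%MM.
    have [|m' minm' le_m'] := @exists_minimal_monomial (nth 0%MM s t).
      by apply: (monomial_ideal_supp Ip); apply: mem_nth.
    by exists m'; rewrite minm'.
  have [h hP] := fin_all_exists exmin.
  exists (size s),
    (fun t : 'I_(size s) => p@_(nth 0%MM s t) *: 'X_[nth 0%MM s t - h t]),
    (fun t : 'I_(size s) => 'X_[h t]).
  split=> [t|]; first by exists (h t) => //; have /andP[] := hP t.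
  rewrite {1}[p]mpolyE (big_nth 0%MM) big_mkord; apply: eq_bigr => t _.
  by rewrite -scalerAl -mpolyXD submK //; have /andP[] := hP t.
have /genG[r [a [g [Gg eqm]]]] : 'X_[m] \in I by have /andP[] := minm.
have spanm :
    ideal_span (fun q => exists2 m', G 'X_[m'] & q = 'X_[m']) 'X_[K, m].
  exists r, a, g; split=> // t; have [m' _ eqg] := subG _ (Gg t).
  by exists m'; rewrite -?eqg.
have [|m' Gm' le_m'] := span_monomials_supp spanm (_ : m \in msupp 'X_[K, m]).
  by rewrite msuppX inE.
suff <- : m' = m by [].
apply: minimal_monomialP minm _ le_m'; apply/genG.
exists 1%N, (fun=> 1), (fun=> 'X_[m']).
by split=> [_|]; [exact: Gm' | rewrite big_ord1 mul1r].
Qed.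

(** The form in which generation in degree d is used: the minimal monomials are
    a homogeneous minimal generating set, so all of them have degree d. *)
Lemma generated_in_degree_divisor d m :
    generated_in_degree I d -> 'X_[m] \in I ->
  exists m', [/\ (m' <= m)%MM, mdeg m' = d & 'X_[m'] \in I].
Proof.
move=> genI /exists_minimal_monomial[m' minm' le_m']; exists m'.
have Im' : 'X_[m'] \in I by have /andP[] := minm'.
split=> //; apply/eqP; rewrite -(dhomogX K).
apply: genI minimal_monomials_generate _ _ _; last by exists m'.
by move=> _ [q _ ->]; exists (mdeg q); rewrite dhomogX.
Qed.

End MonomialIdeal.

(** * Forms in two variables times a fixed monomial *)

Section Fibre.
Variables (K : fieldType) (n : nat) (i j : 'I_n).
Hypothesis neq_ij : i != j.
Implicit Types (m : 'X_{1..n}) (f : {mpoly K[n]}) (p : {poly K}).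

Definition fibre_mnm m b c : 'X_{1..n} := (U_(i) *+ b + U_(j) *+ c + m)%MM.

Lemma fibre_mnmE m b c k :
  fibre_mnm m b c k = ((i == k) * b + (j == k) * c + m k)%N.
Proof. by rewrite !mnmDE !mulmnE !mnm1E. Qed.

Lemma mdeg_fibre_mnm m b c : mdeg (fibre_mnm m b c) = (b + c + mdeg m)%N.
Proof. by rewrite !mdegD !mdegMn !mdeg1 !mul1n. Qed.

Lemma fibre_mnmSl m b c : fibre_mnm m b.+1 c = (U_(i) + fibre_mnm m b c)%MM.
Proof. by apply/mnmP=> k; rewrite mnmDE mnm1E !fibre_mnmE mulnS !addnA. Qed.

Lemma fibre_mnmSr m b c : fibre_mnm m b c.+1 = (U_(j) + fibre_mnm m b c)%MM.
Proof.
by apply/mnmP=> k; rewrite mnmDE mnm1E !fibre_mnmE mulnS addnCA !addnA.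
Qed.

Lemma mcoeffMX_eq0 f k m : m k = 0%N -> (f * 'X_k)@_m = 0.
Proof.
move=> mk0; apply/eqP; rewrite mcoeff_eq0 (perm_mem (msuppMX _ _)).
apply/mapP=> -[m' _ eqm]; move/mnmP/(_ k): eqm.
by rewrite mk0 mnmDE mnm1E eqxx.
Qed.

(** The dehomogenization at x_j = 1 of the part of f of the form
    m * p(x_i, x_j), with p a form of degree s. *)
Definition fibre s m f : {poly K} :=
  \poly_(b < s.+1) f@_(fibre_mnm m b (s - b)).

Lemma fibreD s m f g : fibre s m (f + g) = fibre s m f + fibre s m g.
Proof.
apply/polyP=> b; rewrite coefD !coef_poly mcoeffD.
by case: ifP => // _; rewrite addr0.
Qed.

(** The base m must be free of x_i and x_j: otherwise the fibre omits the
    monomials with a smaller exponent, which also contribute to the product. *)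
Lemma fibreM s m f : m i = 0%N -> m j = 0%N ->
  fibre s.+1 m (f * ('X_i + 'X_j)) = ('X + 1) * fibre s m f.
Proof.
move=> mi0 mj0; rewrite mulrDr fibreD mulrDl mul1r.
congr (_ + _); apply/polyP=> b.
  rewrite coefXM !coef_poly; case: b => [|b] /=.
    by rewrite mcoeffMX_eq0 // fibre_mnmE eqxx mi0 eq_sym (negPf neq_ij).
  by rewrite ltnS; case: ifP => // _; rewrite subSS fibre_mnmSl mcoeffMX.
rewrite !coef_poly; have [lt_b|] := ltnP b s.+1.
  by rewrite ltnW // subSn // fibre_mnmSr mcoeffMX.
rewrite -subn_eq0 => /eqP ->; case: ifP => // _.
by rewrite mcoeffMX_eq0 // fibre_mnmE eqxx (negPf neq_ij) mj0.
Qed.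

Lemma fibreM_exp s m f t : m i = 0%N -> m j = 0%N ->
  fibre (s + t) m (('X_i + 'X_j) ^+ t * f) = ('X + 1) ^+ t * fibre s m f.
Proof.
move=> mi0 mj0; elim: t => [|t IH]; first by rewrite addn0 !mul1r.
by rewrite addnS exprSr mulrAC fibreM // IH mulrA -exprS.
Qed.

Definition homogenize s m p : {mpoly K[n]} :=
  \sum_(b < s.+1) p`_b *: 'X_[fibre_mnm m b (s - b)].

(** Without the bound on the degree, [homogenize] truncates p on the right-hand
    side but keeps one more coefficient on the left. *)
Lemma homogenizeM s m p : (size p <= s.+1)%N ->
  homogenize s.+1 m (('X + 1) * p) = ('X_i + 'X_j) * homogenize s m p.
Proof.
move=> sz_p; rewrite /homogenize mulrDl mul1r.
under eq_bigr do rewrite coefD scalerDl.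
rewrite big_split /= mulrDl; congr (_ + _).
  rewrite big_ord_recl coefXM eqxx scale0r add0r mulr_sumr.
  apply: eq_bigr => b _; rewrite coefXM -scalerAr /=.
  by rewrite /bump add1n subSS fibre_mnmSl mpolyXD.
rewrite big_ord_recr /= (leq_sizeP _ _ sz_p) // scale0r addr0 mulr_sumr.
apply: eq_bigr => b _; rewrite -scalerAr subSn -1?ltnS //.
by rewrite fibre_mnmSr mpolyXD.
Qed.

Lemma homogenizeM_exp s m p t : (size p <= s.+1)%N ->
  homogenize (s + t) m (('X + 1) ^+ t * p) =
    ('X_i + 'X_j) ^+ t * homogenize s m p.
Proof.
move=> sz_p; elim: t => [|t IH]; first by rewrite addn0 !mul1r.
rewrite addnS exprS -mulrA homogenizeM ?IH ?mulrA -?exprS //.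
rewrite (leq_trans (size_polyMleq _ _)) // size_XD1_exp addSn /= addnC.
by rewrite -addSn leq_add2r.
Qed.

End Fibre.

(** * Monomials and their divisors *)

Section Divisors.
Variable n : nat.
Implicit Types m : 'X_{1..n}.

Lemma mnm_le_mdeg m k : (m k <= mdeg m)%N.
Proof. by rewrite mdegE (bigD1 k) //= leq_addr. Qed.

Lemma exists_mnm_divisor m e : (e <= mdeg m)%N ->
  exists2 m', (m' <= m)%MM & mdeg m' = e.
Proof.
elim: e => [|e IH] le_e; first by
  exists 0%MM; rewrite ?mdeg0 //; apply/mnm_lepP=> k; rewrite mnm0E.
have [m' le_m' dm'] := IH (ltnW le_e).
have: mdeg (m - m') != 0%N by rewrite -(submK le_m') mdegD in le_e; lia.
rewrite mdeg_eq0 => /eqP nz.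
have [k lt_k] : exists k, (m' k < m k)%N.
  apply/existsP; apply: contraT => /existsPn ge_m; case: nz; apply/mnmP=> k.
  by rewrite mnmBE mnm0E; have := ge_m k; lia.
exists (U_(k) + m')%MM; last by rewrite mdegD mdeg1 dm'.
apply/mnm_lepP=> l; move/mnm_lepP/(_ l): le_m'; rewrite mnmDE mnm1E.
by case: eqP => [<-|] /=; lia.
Qed.

Variables i j : 'I_n.
Hypothesis neq_ij : i != j.

Lemma fibre_mnm_decomp m : exists m0 : 'X_{1..n},
  [/\ m0 i = 0%N, m0 j = 0%N & m = fibre_mnm i j m0 (m i) (m j)].
Proof.
exists (m - (U_(i) *+ m i + U_(j) *+ m j))%MM.
rewrite !mnmBE !mnmDE !mulmnE !mnm1E !eqxx (negPf neq_ij) eq_sym (negPf neq_ij).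
split; try lia; apply/mnmP => k.
rewrite fibre_mnmE mnmBE mnmDE !mulmnE !mnm1E.
case: eqP => [<-|_]; first by rewrite eq_sym (negPf neq_ij); lia.
by case: eqP => [<-|_]; lia.
Qed.
End Divisors.

(** * The Lefschetz maps *)

Section Lefschetz.
Variables (K : fieldType) (n D : nat) (I : ideal {mpoly K[n]}) (i j : 'I_n).
Hypothesis charK0 : [pchar K] =i pred0.
Hypothesis monI : monomial_ideal I.
Hypothesis genI : generated_in_degree I D.+1.
Hypothesis neq_ij : i != j.
Hypothesis Iij : forall m : 'X_{1..n}, mdeg m = D.+1 ->
  ((U_(i) + U_(j) <= m)%MM <-> 'X_[K, m] \notin I).

Lemma mnm_mem_generators m : mdeg m = D.+1 ->
  ('X_[m] \in I) = (m i == 0%N) || (m j == 0%N).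
Proof.
move/Iij => Im; apply: negb_inj; rewrite negb_or.
have -> : (m i != 0%N) && (m j != 0%N) = (U_(i) + U_(j) <= m)%MM.
  apply/andP/mnm_lepP => [[mi mj] k|le_m].
    rewrite mnmDE !mnm1E; case: eqP => [<-|_]; last by case: eqP => [<-|_]; lia.
    by rewrite eq_sym (negPf neq_ij); lia.
  have := le_m i; have := le_m j; rewrite !mnmDE !mnm1E !eqxx.
  by lia.
by apply/idP/idP => /Im.
Qed.

(** If the exponent of x_i is less than N, removing all copies of x_i leaves
    degree at least d, hence a generator prime to x_i. Conversely, a
    generator prime to x_i has a cofactor of degree N - 1, which bounds the
    exponent of x_i. The same holds for x_j. *)
Lemma mnm_notin_degD N m : mdeg m = (D + N)%N ->
  ('X_[m] \notin I) = (N <= m i)%N && (N <= m j)%N.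
Proof.
move=> dm; apply/idP/idP => [|/andP[le_i le_j]].
  apply: contraR => not_le.
  have [k lt_k memk] : exists2 k, (m k < N)%N &
      forall m', mdeg m' = D.+1 -> m' k = 0%N -> 'X_[m'] \in I.
    move: not_le; rewrite negb_and -!ltnNge.
    move=> /orP[lt|lt]; [exists i | exists j] => //.
      by move=> m' /mnm_mem_generators -> ->.
    by move=> m' /mnm_mem_generators -> ->; rewrite orbT.
  have le_k : (U_(k) *+ m k <= m)%MM.
    by apply/mnm_lepP=> l; rewrite mulmnE mnm1E; case: eqP => [<-|_]; lia.
  have [|m' le_m' dm'] := @exists_mnm_divisor _ (m - U_(k) *+ m k)%MM D.+1.
    by have := dm; rewrite -{1}(submK le_k) mdegD mdegMn mdeg1; lia.
  have Im' : 'X_[m'] \in I.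
    apply: memk => //; move/mnm_lepP/(_ k): le_m'.
    by rewrite mnmBE mulmnE mnm1E eqxx; lia.
  exact: mpolyX_mem_le (lepm_trans le_m' (lem_subr _ _)) Im'.
apply/negP => /(generated_in_degree_divisor monI genI)[m' [le_m' dm']].
rewrite mnm_mem_generators //.
have : (mdeg (m - m') + D.+1 = D + N)%N by rewrite -dm -dm' -mdegD submK.
have := mnm_le_mdeg (m - m')%MM i; have := mnm_le_mdeg (m - m')%MM j.
by rewrite !mnmBE; lia.
Qed.

Local Notation l := ('X_i + 'X_j : {mpoly K[n]}).

(** On every fibre, membership of l^(2N) f in I says exactly that the
    coefficients N, ..., N + s of the dehomogenized product vanish. *)
Lemma lefschetz_inj N f : (N <= D)%N -> f \is (D - N).-homog ->
  l ^+ N.*2 * f \in I -> f = 0.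
Proof.
move=> leN hf If; apply/mpolyP => m; rewrite mcoeff0.
apply/eqP; apply: contraT; rewrite -mcoeff_msupp => fm.
have dm : mdeg m = (D - N)%N := dhomog_mf hf fm.
have [m0 [m0i m0j eqm]] := fibre_mnm_decomp neq_ij m.
(* f@_m is the coefficient of X^b in the fibre of degree b + c over m0. *)
move: (m i) (m j) eqm => b c eqm; rewrite {}eqm in fm dm.
rewrite mdeg_fibre_mnm in dm.
have g0 : ('X + 1) ^+ N.*2 * fibre i j (b + c) m0 f = 0.
  apply: (@gap_poly_eq0 _ charK0 N (b + c)); first exact: dvdp_mulIl.
    by rewrite -fibreM_exp // (leq_trans (size_poly _ _)) // addnC addnS.
  move=> k le_k; rewrite -fibreM_exp // coef_poly; case: ifP => // lt_k.
  apply/eqP; rewrite mcoeff_eq0; apply/negP=> /(monomial_ideal_supp monI If).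
  apply/negP; rewrite (@mnm_notin_degD N) ?mdeg_fibre_mnm; last by lia.
  rewrite !fibre_mnmE !eqxx (negPf neq_ij) eq_sym (negPf neq_ij).
  by lia.
move/eqP: g0; rewrite mulf_eq0 -size_poly_eq0 size_XD1_exp /= => /eqP.
move/(congr1 (fun p : {poly K} => p`_b)).
rewrite coef0 coef_poly ltnS leq_addr addKn.
by move: fm; rewrite mcoeff_msupp => /eqP.
Qed.

(** The socle degree is 2D: x^N y^N has degree 2N > D + N when N > D. *)
Lemma mnm_mem_above_socle N m : (D < N)%N -> mdeg m = (D + N)%N -> 'X_[m] \in I.
Proof.
move=> ltN dm; apply: contraT; rewrite (mnm_notin_degD dm) => le_N.
have [m0 [m0i m0j eqm]] := fibre_mnm_decomp neq_ij m.
by have := mdeg_fibre_mnm i j m0 (m i) (m j); rewrite -eqm dm; lia.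
Qed.

(** A basis monomial of (S/I)_(D+N) is x^(N+a) y^(N+s-a) m0; inverting the
    matrix of central coefficients gives a form on the fibre of m0 whose image
    agrees with it at all monomials outside I. *)
Lemma lefschetz_surj_mnm N m : (N <= D)%N -> mdeg m = (D + N)%N ->
  exists2 f, f \is (D - N).-homog & 'X_[m] - l ^+ N.*2 * f \in I.
Proof.
move=> leN dm; have [Im|] := boolP ('X_[m] \in I).
  by exists 0; rewrite ?dhomog0 // mulr0 subr0.
rewrite (mnm_notin_degD dm) => /andP[le_i le_j].
have [m0 [m0i m0j eqm]] := fibre_mnm_decomp neq_ij m.
have dm0 := mdeg_fibre_mnm i j m0 (m i) (m j); rewrite -eqm dm in dm0.
(* The fibre through m has degree s after division by (x_i x_j)^N. *)
pose s := (m i + m j - N.*2)%N.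
have lt_a : (m i - N < s.+1)%N by lia.
pose v : 'rV[K]_s.+1 := delta_mx 0 (Ordinal lt_a) *m invmx (central_mx K N s).
have coefv b : (N <= b <= N + s)%N ->
    (('X + 1) ^+ N.*2 * rVpoly v)`_b = (b == m i)%:R.
  move=> le_b; have lt_bN : (b - N < s.+1)%N by lia.
  rewrite [in LHS](_ : b = (N + Ordinal lt_bN)%N) /=; last by lia.
  rewrite -(mul_central_mx N v (Ordinal lt_bN)) mulmxKV ?central_mx_unit //.
  by rewrite mxE eqxx -val_eqE /=; congr (_ %:R); lia.
exists (homogenize i j s m0 (rVpoly v)).
  apply: rpred_sum => b _; apply: rpredZ; rewrite dhomogX /= mdeg_fibre_mnm.
  by have := ltn_ord b; lia.
rewrite -homogenizeM_exp ?size_poly //.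
have lt_b : (m i < (s + N.*2).+1)%N by lia.
rewrite /homogenize (bigD1 (Ordinal lt_b)) //=.
have -> : (s + N.*2 - m i = m j)%N by lia.
rewrite coefv; last by lia.
rewrite eqxx scale1r -eqm opprD addrA subrr add0r rpredN.
apply: rpred_sum => b; rewrite -val_eqE /= => neq_b.
have [inI|notI] := boolP ('X_[K, fibre_mnm i j m0 b (s + N.*2 - b)] \in I).
  by rewrite -mul_mpolyC ideal_mull.
have := ltn_ord b; move: notI.
rewrite (@mnm_notin_degD N) ?mdeg_fibre_mnm; last first.
  by have := ltn_ord b; lia.
rewrite !fibre_mnmE !eqxx (negPf neq_ij) eq_sym (negPf neq_ij) => le_b lt_bs.
rewrite coefv; last by lia.
by rewrite (negPf neq_b) scale0r rpred0.
Qed.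

Lemma lefschetz_surj N f : (N <= D)%N -> f \is (D + N).-homog ->
  exists2 g, g \is (D - N).-homog & f - l ^+ N.*2 * g \in I.
Proof.
move=> leN /dhomog_mf hf; rewrite [f]mpolyE big_seq.
apply: (big_ind (fun f =>
  exists2 g, g \is (D - N).-homog & f - l ^+ N.*2 * g \in I)).
- by exists 0; rewrite ?dhomog0 // mulr0 subr0 rpred0.
- move=> f1 f2 [g1 hg1 I1] [g2 hg2 I2]; exists (g1 + g2); first exact: rpredD.
  by rewrite mulrDr opprD addrACA rpredD.
move=> m /hf /(lefschetz_surj_mnm leN)[g hg Ig].
exists (f@_m *: g); first exact: rpredZ.
by rewrite -scalerAr -scalerBr -mul_mpolyC ideal_mull.
Qed.

(** A map l^k from degree e that lands on or before the mirror image 2D - e of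
    e is a first factor of a central bijection, hence injective. If it lands on
    or after it, it is a last factor of one, or its target is 0, hence it is
    surjective. *)
Lemma central_lefschetz_slp : strong_lefschetz_property I.
Proof.
have hl : l \is 1.-homog by rewrite rpredD // dhomogX /= mdeg1.
have hlX k e f : f \is e.-homog -> l ^+ k * f \is (k + e).-homog.
  by move=> hf; apply: dhomogM => //; have := dhomogMn k hl; rewrite mul1n.
exists (quot_proj I l); first by exists l.
move=> e k; have [le_ek|gt_ek] := leqP (e.*2 + k) D.*2; [left|right].
  move=> _ _ [p hp ->] [q hq ->].
  rewrite -rmorphXn -!rmorphM => /quot_proj_eqP; rewrite -mulrBr => Ipq.
  have leD : (D - e <= D)%N by lia.
  suff /eqP : p - q = 0 by rewrite subr_eq0 => /eqP ->.
  apply: (lefschetz_inj leD).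
    by rewrite subKn ?rpredB //; lia.
  have -> : ((D - e).*2 = (D - e).*2 - k + k)%N by lia.
  by rewrite exprD -mulrA ideal_mull.
move=> _ [q hq ->]; pose N := (e + k - D)%N.
rewrite (_ : (e + k = D + N)%N) in hq; last by lia.
have [leN|ltN] := leqP N D.
  have [g hg Ig] := lefschetz_surj leN hq.
  exists (quot_proj I (l ^+ (e - (D - N)) * g)).
    exists (l ^+ (e - (D - N)) * g) => //.
    by rewrite -[X in X.-homog](_ : (e - (D - N) + (D - N) = e)%N) ?hlX //; lia.
  rewrite -rmorphXn -rmorphM mulrA -exprD; apply/esym/quot_proj_eqP.
  by rewrite (_ : (k + (e - (D - N)) = N.*2)%N) //; lia.
exists 0; first by exists 0; rewrite ?dhomog0 ?rmorph0.
rewrite mulr0 -[LHS](rmorph0 (quot_proj I)); apply/esym/quot_proj_eqP.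
rewrite subr0; apply: mem_ideal_supp => m /(dhomog_mf hq).
exact: mnm_mem_above_socle.
Qed.
End Lefschetz.

Theorem theorem3p10 (K : fieldType) (n d : nat) (I : ideal {mpoly K[n]})
    (charK0 : [pchar K] =i pred0)
    (artI : artinian_ideal I)
    (monI : monomial_ideal I)
    (genI : generated_in_degree I d)
    (hij : exists i j : 'I_n, (i < j)%N /\
       forall m : 'X_{1..n}, mdeg m = d ->
         ((U_(i) + U_(j) <= m)%MM <-> 'X_[K, m] \notin I)) :
  strong_lefschetz_property I.
Proof.
have [i [j [lt_ij Iij]]] := hij.
have neq_ij : i != j by apply: contraTneq lt_ij => ->; rewrite ltnn.
case: d genI Iij {hij} => [|D] genI Iij; last first.
  exact: (central_lefschetz_slp charK0 monI genI neq_ij Iij).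
(* For d = 0 no monomial of degree 0 is divisible by x_i x_j, so I = S. *)
have I1 : 1 \in I.
  apply: contraT; rewrite -mpolyX0 => /(Iij _ (@mdeg0 n))/mnm_lepP/(_ i).
  by rewrite mnmDE mnm1E eqxx mnm0E.
exists 0; first by exists 0; rewrite ?dhomog0 ?rmorph0.
move=> e k; left=> x y _ _ _.
have [p <-] := quot_proj_surj x; have [q <-] := quot_proj_surj y.
by apply/quot_proj_eqP; rewrite -[p - q]mulr1 ideal_mull.
Qed.
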